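(* Let $m\ge 3$ be odd, let $0\le i<j<m$ be integers, $\rho=2^i+2^j$, $\kappa=j-i$, and $\Gamma_\rho(x)=x^\rho+x$ on $\mathrm{GF}(2^m)$. Suppose $\Gamma_\rho$ is two-to-one on $\mathrm{GF}(2^m)$ (every element of $\mathrm{GF}(2^m)$ has either exactly $2$ or no preimages) and $\gcd(2^\kappa+1,2^m-1)=1$. Let $D(\Gamma_\rho)=\{\Gamma_\rho(x):x\in\mathrm{GF}(2^m)\}\setminus\{0\}$. Then the binary code $\mathcal{C}_{D(\Gamma_\rho)}$ has parameters $[2^{m-1}-1,\ m,\ 2^{m-2}-2^{(m-3)/2}]$ and its nonzero weights and their multiplicities are: weight $2^{m-2}-2^{(m-3)/2}$ with multiplicity $2^{m-2}+2^{(m-3)/2}$; weight $2^{m-2}$ with multiplicity $2^{m-1}-1$; weight $2^{m-2}+2^{(m-3)/2}$ with multiplicity $2^{m-2}-2^{(m-3)/2}$.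
   Context: $\mathrm{Tr}$ denotes the absolute trace from $\mathrm{GF}(2^m)$ onto $\mathrm{GF}(2)$. For a subset $D=\{d_1,\dots,d_n\}\subseteq\mathrm{GF}(2^m)$ (listed in a fixed order), $\mathcal{C}_D=\{(\mathrm{Tr}(xd_1),\dots,\mathrm{Tr}(xd_n)) : x\in\mathrm{GF}(2^m)\}$, a binary linear code of length $n$. *)

(* Defs.v *)
From HB Require Import structures.
From mathcomp Require Import all_boot all_order all_algebra all_field.
Set Implicit Arguments. Unset Strict Implicit. Unset Printing Implicit Defensive.
Import GRing.Theory.
Local Open Scope ring_scope.

(* Absolute trace GF(2^m) -> GF(2): Tr(x) = sum_{k<m} x^(2^k).
   (Its values lie in the prime field {0,1} of F when #|F| = 2^m.) *)
Definition absTr (F : finFieldType) (m : nat) (x : F) : F :=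
  \sum_(k < m) x ^+ (2 ^ k).

Definition Gamma (F : finFieldType) (rho : nat) (x : F) : F := x ^+ rho + x.

Definition DGamma (F : finFieldType) (rho : nat) : {set F} :=
  [set Gamma rho x | x in F] :\ 0.

Definition codeword (F : finFieldType) (m : nat) (D : {set F}) (x : F)
  : {ffun 'I_#|D| -> F} :=
  [ffun k : 'I_#|D| => absTr m (x * enum_val k)].

(* The code C_D as a set of vectors (entries in GF(2) = {0,1} inside F). *)
Definition codeD (F : finFieldType) (m : nat) (D : {set F})
  : {set {ffun 'I_#|D| -> F}} :=
  [set codeword m D x | x in F].

Definition wt (F : finFieldType) (n : nat) (c : {ffun 'I_n -> F}) : nat :=
  #|[set k | c k != 0]|.

(* Main.v *)
Require Import Defs.
From HB Require Import structures.
From mathcomp Require Import all_boot all_order all_algebra all_field.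
From mathcomp Require Import cyclic zify ring.
Import GRing.Theory.

(** Write rho = 2^i + 2^j and f(x) = x^rho.  For c != 0 put c = e^rho; then
    W(c) = sum_x (-1)^Tr(c Gamma(x)) is the exponential sum of the quadratic
    form Tr(y^rho + (c/e) y), whose polar form has radical {u : u^(2^(2 kappa)) = u}.
    When gcd(kappa, m) = 1 this radical is GF(2), so W(c) is 0 or +-2^((m+1)/2);
    the weight of the codeword of c is (2^m - W(c)) / 4, and the first two moments
    of W give the multiplicities.

    That gcd(kappa, m) = 1 has to be extracted from the two-to-one hypothesis.
    Let d = gcd(kappa, m), and suppose d > 1.  Two-to-oneness means that no three
    points of the graph of f are collinear (x^rho is an o-monomial).
    - If d does not divide i, collinearity of the points over x, x + 1, x + t is an
      equation L(x) = t^rho + t with L linearized, so L is singular for every t;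
      this gives N(t + t^(2^i)) = N(t + t^(2^j)) for the norm N to GF(2^d), and
      comparing one coefficient in t is contradictory.
    - If d divides i, Glynn's criterion is violated by a minimal nonempty set R of
      multiples of d in Z/m such that each l in R has l - i or l - j in R. *)

(** * Binary digits modulo 2^m - 1 *)

Definition binsum (m : nat) (A : {set 'I_m}) : nat := \sum_(l in A) 2 ^ l.

Lemma sum_bits_inj (m : nat) (f g : 'I_m -> bool) :
  \sum_(l < m) f l * 2 ^ l = \sum_(l < m) g l * 2 ^ l -> f =1 g.
Proof.
elim: m f g => [f g _ [] //|m IH f g].
have split2 (h : 'I_m.+1 -> bool) : \sum_(l < m.+1) h l * 2 ^ l =
    h ord0 + 2 * \sum_(l < m) h (lift ord0 l) * 2 ^ l.
  rewrite big_ord_recl /= muln1 big_distrr /=; congr (_ + _)%N.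
  by apply: eq_bigr => l _; rewrite mulnCA -expnS.
rewrite !split2 => E.
have E0 : f ord0 = g ord0.
  by have := congr1 odd E; rewrite !mul2n !oddD !odd_double !addbF !oddb.
move: E; rewrite E0 => /addnI/eqP; rewrite eqn_mul2l /= => /eqP/IH E1 l.
by case: (unliftP ord0 l) => [k|] ->; rewrite ?E1.
Qed.

Lemma binsumE (m : nat) (A : {set 'I_m}) :
  binsum m A = \sum_(l < m) (l \in A) * 2 ^ l.
Proof.
by rewrite /binsum big_mkcond; apply: eq_bigr => l _; case: (l \in A); rewrite ?mul1n.
Qed.

Lemma binsum_inj (m : nat) : injective (binsum m).
Proof. by move=> A B; rewrite !binsumE => /sum_bits_inj E; apply/setP. Qed.

Lemma binsumT (m : nat) : binsum m setT = 2 ^ m - 1.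
Proof.
rewrite subn1 predn_exp mul1n /binsum; apply: eq_bigl => l.
by rewrite inE.
Qed.

Lemma binsum0 (m : nat) : binsum m set0 = 0.
Proof. by rewrite /binsum big_set0. Qed.

Lemma binsumC (m : nat) (A : {set 'I_m}) :
  binsum m A + binsum m (~: A) = 2 ^ m - 1.
Proof.
rewrite -binsumT /binsum [RHS](bigID (mem A)) /=.
by congr (_ + _)%N; apply: eq_bigl => l; rewrite !inE.
Qed.

Lemma binsumU (m : nat) (A B : {set 'I_m}) : [disjoint A & B] ->
  binsum m (A :|: B) = binsum m A + binsum m B.
Proof. by move=> AB; rewrite /binsum (eq_bigl [predU A & B]) ?bigU // => l; rewrite !inE. Qed.

Lemma binsum_le (m : nat) (A : {set 'I_m}) : binsum m A <= 2 ^ m - 1.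
Proof. by rewrite -(binsumC m A) leq_addr. Qed.

Lemma binsum_gt0 (m : nat) (A : {set 'I_m}) : A != set0 -> 0 < binsum m A.
Proof.
by rewrite lt0n; apply: contraNneq => E; apply/eqP/(binsum_inj m); rewrite binsum0.
Qed.

Lemma binsum_lt (m : nat) (A : {set 'I_m}) : A != setT -> binsum m A < 2 ^ m - 1.
Proof.
rewrite ltn_neqAle binsum_le andbT; apply: contraNneq => E.
by apply/eqP/(binsum_inj m); rewrite binsumT.
Qed.

(** Digit sets have values from 0 to 2^m - 1, so the only collision modulo 2^m - 1 is between [set0]
    and [setT]. *)
Lemma binsum_mod_inj (m : nat) (A B : {set 'I_m}) : A != set0 -> A != setT ->
  binsum m A = binsum m B %[mod 2 ^ m - 1] -> A = B.
Proof.
move=> A0 AT; have := binsum_le m B; have := binsum_lt m A AT.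
have := binsum_gt0 m A A0 => sA0 sAN; rewrite leq_eqVlt => /orP[/eqP->|sBN].
  by rewrite modnn modn_small // => E; rewrite E in sA0.
by rewrite !modn_small //; exact: (binsum_inj m).
Qed.

Lemma exp2_modn (m a : nat) : 2 ^ (a %% m) = 2 ^ a %[mod 2 ^ m - 1].
Proof.
have t1 : 2 ^ m = 1 %[mod 2 ^ m - 1].
  by rewrite -{1}(@subnK 1 (2 ^ m)) ?expn_gt0 // modnDl.
have tq q : 2 ^ (q * m) = 1 %[mod 2 ^ m - 1].
  by rewrite mulnC expnM -modnXm t1 modnXm exp1n.
by rewrite [in RHS](divn_eq a m) expnD -modnMml tq modnMml mul1n.
Qed.

(** Cyclic shift of the digit positions: the effect on digit sets of multiplying by 2^k modulo 2^m -
    1. *)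
Definition rot_digit (m : nat) (m_gt0 : 0 < m) (k : nat) (l : 'I_m) : 'I_m :=
  Ordinal (ltn_pmod (l + k) m_gt0).

Lemma rot_digit_inj (m : nat) (m_gt0 : 0 < m) (k : nat) :
  injective (rot_digit m m_gt0 k).
Proof.
move=> l l' /(congr1 val) /= /eqP; rewrite eqn_modDr !modn_small //.
by move/eqP/val_inj.
Qed.

Lemma binsum_rot (m : nat) (m_gt0 : 0 < m) (k : nat) (A : {set 'I_m}) :
  binsum m (rot_digit m m_gt0 k @: A) = 2 ^ k * binsum m A %[mod 2 ^ m - 1].
Proof.
rewrite /binsum big_imset /=; last by move=> l l' _ _; apply: rot_digit_inj.
rewrite big_distrr /=; elim/big_rec2: _ => // l a b _ E.
by rewrite -modnDm exp2_modn E modnDm expnD [2 ^ l * _]mulnC.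
Qed.

Lemma expr_modn (R : nzRingType) (x : R) (a b N : nat) :
  (x ^+ N = 1)%R -> a = b %[mod N] -> (x ^+ a = x ^+ b)%R.
Proof.
move=> xN E; rewrite (divn_eq a N) (divn_eq b N) E.
by rewrite !exprD ![(_ * N)%N]mulnC !exprM xN !expr1n.
Qed.

Lemma wt0 (F : finFieldType) (n : nat) : wt (0%R : {ffun 'I_n -> F}) = 0.
Proof.
rewrite /wt; apply/eqP; rewrite cards_eq0; apply/eqP/setP => k.
by rewrite !inE ffunE eqxx.
Qed.

(** * Finite fields of characteristic two *)

Section FiniteField.
Local Open Scope ring_scope.
Variables (F : finFieldType) (m : nat).
Hypotheses (hF : #|F| = (2 ^ m)%N) (m_gt0 : (0 < m)%N).

Lemma pchar2 : 2 \in [char F].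
Proof. exact: card_finPcharP hF _. Qed.

Lemma addxx (x : F) : x + x = 0.
Proof. by rewrite -mulr2n -mulr_natr (pcharf0 pchar2) mulr0. Qed.

Lemma oppx (x : F) : - x = x.
Proof. by apply/eqP; rewrite eq_sym -addr_eq0 addxx. Qed.

Lemma addx_eq0 (x y : F) : (x + y == 0) = (x == y).
Proof. by rewrite addr_eq0 oppx. Qed.

Lemma frobD (k : nat) (x y : F) : (x + y) ^+ (2 ^ k) = x ^+ (2 ^ k) + y ^+ (2 ^ k).
Proof. by apply: exprDn_pchar; rewrite pnatX pnatE // pchar2. Qed.

Lemma frob_inj (k : nat) : injective (fun x : F => x ^+ (2 ^ k)).
Proof.
move=> x y /= E; apply/eqP; rewrite -addx_eq0.
have : (x + y) ^+ (2 ^ k) == 0 by rewrite frobD E addxx.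
by rewrite expf_eq0 => /andP[].
Qed.

Lemma exprN1 (x : F) : x != 0 -> x ^+ (2 ^ m - 1) = 1.
Proof.
move=> x0; apply: (mulfI x0); rewrite -exprS mulr1 subn1 prednK ?expn_gt0 //.
by rewrite -hF expf_card.
Qed.

Lemma expr_card_modn (x : F) (a b : nat) : (0 < a)%N -> (0 < b)%N ->
  a = b %[mod 2 ^ m - 1] -> x ^+ a = x ^+ b.
Proof.
move=> a0 b0 E; have [->|x0] := eqVneq x 0; first by rewrite !expr0n !eqn0Ngt a0 b0.
exact: expr_modn (exprN1 x x0) E.
Qed.

Lemma card_gt1 : (0 < 2 ^ m - 1)%N.
Proof. by rewrite subn_gt0 -{1}(expn0 2) ltn_exp2l. Qed.

Lemma prim_root_exists : exists g : F, (2 ^ m - 1)%N.-primitive_root g.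
Proof.
have /hasP[g _ pg] : has (2 ^ m - 1)%N.-primitive_root (enum [pred x : F | x != 0]).
  apply: has_prim_root; rewrite ?card_gt1 ?enum_uniq //.
    by apply/allP=> x; rewrite mem_enum inE unity_rootE => /exprN1->.
  rewrite -cardE -hF; have := cardC (pred1 (0 : F)).
  by rewrite card1 /= => <-; rewrite addnC addnK; apply: eq_leq; apply: eq_card.
by exists g.
Qed.

(** Substituting g x for x, with g primitive, multiplies the sum by g^e, so it vanishes unless g^e =
    1; then the nonzero x contribute 2^m - 1, which is 1 in F. For e = 0 the term at x = 0 is 1 as
    well, and the total is 0. *)
Lemma power_sum (e : nat) :
  \sum_(x : F) x ^+ e = ((0 < e) && (2 ^ m - 1 %| e))%N%:R.
Proof.
have card0 : #|F|%:R = 0 :> F.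
  by rewrite hF natrX (pcharf0 pchar2) expr0n eqn0Ngt m_gt0.
case: e => [|e] /=.
  by under eq_bigr do rewrite expr0; rewrite sumr_const cardT -cardE card0.
have [g pg] := prim_root_exists; rewrite (prim_order_dvd pg).
case: eqP => [E|/eqP NE].
  rewrite (bigD1 0) //= expr0n add0r.
  rewrite (eq_bigr (fun=> 1)) => [|x x0]; last first.
    rewrite -(expr0 x); apply: expr_modn (exprN1 x x0) _.
    by apply/eqP; rewrite mod0n -/(dvdn _ _) (prim_order_dvd pg) E.
  rewrite sumr_const; have := cardC (pred1 (0 : F)); rewrite card1 => E2.
  have -> : #|[pred x : F | x != 0]| = #|predC (pred1 (0 : F))| by apply: eq_card.
  by apply/eqP; rewrite -addx_eq0 -{2}[1](mulr1n 1) addrC -mulrnDr E2 card0.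
have g0 : g != 0.
  apply/eqP => g0; have := prim_expr_order pg.
  by rewrite g0 expr0n eqn0Ngt card_gt1 => /eqP; rewrite eq_sym oner_eq0.
have : (g ^+ e.+1 - 1) * \sum_(x : F) x ^+ e.+1 = 0.
  rewrite mulrBl mul1r mulr_sumr [X in _ - X](reindex_inj (mulfI g0)) /=.
  by apply/eqP; rewrite subr_eq0; apply/eqP/eq_bigr => x _; rewrite exprMn.
by move/eqP; rewrite mulf_eq0 subr_eq0 (negbTE NE) => /eqP.
Qed.

(** J collects the factors from which x^(u l) is chosen. Together with [power_sum] this reads off
    coefficients of polynomial functions. *)
Lemma power_sum_prod (n : nat) (K : {set 'I_n}) (u v : 'I_n -> nat) (c : nat) :
  \sum_(x : F) x ^+ c * \prod_(l in K) (x ^+ u l + x ^+ v l) =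
  \sum_(J : {set 'I_n} | J \subset K)
    \sum_(x : F) x ^+ (c + \sum_(l in K) if l \in J then u l else v l).
Proof.
rewrite exchange_big /=; apply: eq_bigr => x _.
under [RHS]eq_bigr do rewrite exprD; rewrite -mulr_sumr; congr (_ * _).
(* The value 0 of [f] outside K kills every J not contained in K; the value 1 of [g] is neutral
   there. *)
pose f l := if l \in K then x ^+ u l else 0.
pose g l := if l \in K then x ^+ v l else 1.
transitivity (\prod_l (f l + g l)).
  rewrite big_mkcond; apply: eq_bigr => l _; rewrite /f /g.
  by case: (l \in K); rewrite ?add0r.
rewrite bigA_distr (bigID (fun J : {set 'I_n} => J \subset K)) /= [X in _ + X]big1 ?addr0.
  apply: eq_bigr => J /subsetP sJK; rewrite expr_sum [RHS]big_mkcond.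
  apply: eq_bigr => l _; rewrite /f /g; case: ifP => [/sJK->//|].
  by case: (l \in K).
move=> J /subsetPn[l lJ lK]; rewrite (bigD1 l) //= lJ /f (negbTE lK) mul0r //.
Qed.


Lemma expr_coprime_inj (a : nat) : (0 < a)%N -> coprime a (2 ^ m - 1) ->
  injective (fun x : F => x ^+ a).
Proof.
move=> a0 co x y /= E; have [y0|y0] := eqVneq y 0.
  by apply/eqP; move: E => /eqP; rewrite y0 expr0n eqn0Ngt a0 expf_eq0 a0.
have x0 : x != 0.
  apply: contra_neq y0 => x0; apply/eqP.
  by move/eqP: E; rewrite x0 expr0n eqn0Ngt a0 eq_sym expf_eq0 a0.
have z0 : x / y != 0 by rewrite mulf_neq0 ?invr_eq0.
have za : (x / y) ^+ a = 1 by rewrite exprMn exprVn E divff // expf_neq0.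
have [k pk ka] := prim_order_exists a0 za.
have : (k %| gcdn a (2 ^ m - 1))%N.
  by rewrite dvdn_gcd ka (prim_order_dvd pk) exprN1 ?eqxx.
rewrite (eqP co) (prim_order_dvd pk) => /eqP.
by rewrite expr1 => z1; rewrite -[y]mul1r -z1 divfK.
Qed.

(** * The two-to-one hypothesis forces gcd(j - i, m) = 1 *)

Section TwoToOne.
Variables (i j : nat).
Hypotheses (hij : (i < j)%N) (hjm : (j < m)%N).
Hypothesis h21 : forall y : F,
  #|[set x : F | Gamma (2 ^ i + 2 ^ j) x == y]| \in [:: 0%N; 2%N].
Hypothesis hgcd : gcdn (2 ^ (j - i) + 1) (2 ^ m - 1) = 1%N.

Local Notation rho := (2 ^ i + 2 ^ j)%N.
Local Notation N := (2 ^ m - 1)%N.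

Lemma rho_gt1 : (1 < rho)%N.
Proof. by have := expn_gt0 2 i; have := expn_gt0 2 j; lia. Qed.

Lemma Gamma_fiber_lt3 (x y z : F) : x != y -> x != z -> y != z ->
  Gamma rho x = Gamma rho y -> Gamma rho x = Gamma rho z -> False.
Proof.
move=> xy xz yz Exy Exz; pose A := [set u : F | Gamma rho u == Gamma rho x].
have : (size [:: x; y; z] <= size (enum A))%N.
  apply: uniq_leq_size => [|u].
    by rewrite /= !inE negb_or xy xz yz.
  by rewrite mem_enum !inE => /or3P[] /eqP ->; rewrite ?Exy -?Exz ?eqxx // Exy.
by rewrite -cardE; have := h21 (Gamma rho x); rewrite -/A !inE => /orP[] /eqP ->.
Qed.

(** Since rho = 2^i (2^(j-i) + 1), this is a Frobenius map followed by a power coprime to 2^m -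
    1. *)
Lemma expr_rho_inj : injective (fun x : F => x ^+ rho).
Proof.
move=> x y /=; have -> : rho = (2 ^ i * (2 ^ (j - i) + 1))%N.
  by rewrite mulnDr muln1 -expnD subnKC 1?ltnW // addnC.
rewrite !exprM => E; apply: (frob_inj i).
by apply: expr_coprime_inj E; rewrite ?addn1 // -addn1 /coprime hgcd.
Qed.

(** Since Gamma(z) = z (z^(rho-1) + 1), a ratio z = x / y other than 0 and 1 with z^(rho-1) = 1
    would be a third zero of Gamma. *)
Lemma expr_rho_pred_inj : injective (fun x : F => x ^+ (rho - 1)).
Proof.
have r0 : (0 < rho - 1)%N by rewrite subn_gt0 rho_gt1.
move=> x y /= E; have [y0|y0] := eqVneq y 0.
  by apply/eqP; move: E => /eqP; rewrite y0 expr0n eqn0Ngt r0 expf_eq0 r0.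
have x0 : x != 0.
  apply: contra_neq y0 => x0; apply/eqP.
  by move/eqP: E; rewrite x0 expr0n eqn0Ngt r0 eq_sym expf_eq0 r0.
have [//|xy] := eqVneq x y; exfalso.
have z0 : x / y != 0 by rewrite mulf_neq0 ?invr_eq0.
have z1 : x / y != 1 by apply: contra_neq xy => z1; rewrite -[y]mul1r -z1 divfK.
have E0 z : Gamma rho z = z * (z ^+ (rho - 1) + 1) :> F.
  by rewrite /Gamma mulrDr mulr1 -exprS subn1 prednK // ltnW // rho_gt1.
apply: (Gamma_fiber_lt3 0 1 (x / y)); rewrite 1?eq_sym ?oner_eq0 //.
  by rewrite !E0 expr1n addxx mulr0 mul0r.
by rewrite !E0 mul0r exprMn exprVn E divff ?expf_neq0 // addxx mulr0.
Qed.

Lemma expr_rho_pred_surj (z : F) : exists x : F, x ^+ (rho - 1) = z.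
Proof.
by have /codomP[x ->] := injF_onto expr_rho_pred_inj z; exists x.
Qed.

(* Rescaling turns 2-to-1-ness of [x^rho + x] into that of [x^rho + mu x] for
   every [mu != 0], i.e. no three points of the graph of [x^rho] are collinear. *)
Lemma no_three_collinear (x t : F) : t != 0 -> t != 1 ->
  (x + t) ^+ rho + x ^+ rho <> t * ((x + 1) ^+ rho + x ^+ rho).
Proof.
move=> t0 t1; set mu := (x + 1) ^+ rho + x ^+ rho => E.
have mu0 : mu != 0.
  rewrite addx_eq0; apply/eqP => E0; have /eqP := expr_rho_inj _ _ E0.
  by rewrite -subr_eq0 addrAC subrr add0r oner_eq0.
(* [mu] is the slope of the chord over x and x + 1. With th^(rho-1) = mu, collinear points over x, x
   + 1 and x + t give three elements of one fiber of Gamma after division by [th]. *)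
have [th Eth] := expr_rho_pred_surj mu.
have th0 : th != 0.
  apply: contra_neq mu0 => th0; rewrite -Eth th0 expr0n.
  by rewrite eqn0Ngt subn_gt0 rho_gt1.
have G z : Gamma rho (z / th) = (z ^+ rho + mu * z) / th ^+ rho.
  rewrite -Eth /Gamma mulrDl exprMn exprVn; congr (_ + _).
  have -> : th ^+ rho = th ^+ (rho - 1) * th.
    by rewrite -exprSr subn1 prednK // ltnW // rho_gt1.
  have : th ^+ (rho - 1) != 0 by rewrite expf_neq0.
  by move: (th ^+ (rho - 1)) => w w0; field; rewrite th0 w0.
have ne a b : a != b -> a / th != b / th.
  by apply: contra_neq => /(mulIf _)->//; rewrite invr_eq0.
have ad (a b c : F) : a != b -> x + a != x + b by rewrite (inj_eq (addrI x)).
apply: (Gamma_fiber_lt3 (x / th) ((x + 1) / th) ((x + t) / th)).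
- by apply: ne; rewrite -[X in X != _]addr0 ad // eq_sym oner_eq0.
- by apply: ne; rewrite -[X in X != _]addr0 ad // eq_sym.
- by apply: ne; rewrite ad // eq_sym.
- rewrite !G; congr (_ / _); apply/eqP; rewrite -addx_eq0.
  have -> : x ^+ rho + mu * x + ((x + 1) ^+ rho + mu * (x + 1)) =
    (mu + (mu * x)) + (mu + mu * x) by rewrite /mu; ring.
  by rewrite addxx.
- rewrite !G; congr (_ / _); apply/eqP; rewrite -addx_eq0.
  have -> : x ^+ rho + mu * x + ((x + t) ^+ rho + mu * (x + t)) =
    ((x + t) ^+ rho + x ^+ rho + mu * t) + (mu * x + mu * x) by ring.
  by rewrite E addxx mulrC addxx addr0.
Qed.


(** * The case d not dividing i: comparison of relative norms *)

Section NotDividing.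
Variable d : nat.
Hypotheses (d_gt0 : (0 < d)%N) (dm : (d %| m)%N) (dk : (d %| j - i)%N).
Hypothesis di : ~~ (d %| i)%N.

Local Notation n := (m %/ d)%N.
(* [E = (2^m - 1) / (2^d - 1)], so [z ^+ E] is the norm of [z] to GF(2^d). *)
Local Notation E := (\sum_(l < n) 2 ^ (d * l))%N.

Lemma relative_norm_exp_dvd : (N %| E * (2 ^ (j - i) - 1))%N.
Proof.
have EN : N = ((2 ^ d - 1) * E)%N.
  rewrite !subn1; under eq_bigr do rewrite expnM.
  by rewrite -predn_exp -expnM mulnC divnK.
rewrite EN mulnC; apply: dvdn_mul => //.
by rewrite -(divnK dk) mulnC expnM !subn1 (predn_exp (2 ^ d)) dvdn_mulr.
Qed.

(** The norm x^E lies in GF(2^d) and d divides j - i, so its powers 2^i and 2^j agree. *)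
Lemma expr_relative_norm (x : F) : x ^+ (2 ^ j * E) = x ^+ (2 ^ i * E).
Proof.
have E0 : (0 < E)%N.
  have n0 : (0 < n)%N by rewrite divn_gt0 // dvdn_leq.
  by rewrite (bigD1 (Ordinal n0)) //= muln0.
apply: expr_card_modn; rewrite ?muln_gt0 ?expn_gt0 ?E0 //.
apply/eqP; rewrite eqn_mod_dvd ?leq_mul2r ?leq_exp2l ?(ltnW hij) ?orbT //.
rewrite -mulnBl -{1}(subnKC (ltnW hij)) expnD -{2}[(2 ^ i)%N]muln1 -mulnBr.
by rewrite -mulnA [X in (_ %| _ * X)%N]mulnC dvdn_mull // relative_norm_exp_dvd.
Qed.

(* Otherwise [x |-> (t + t^(2^i)) x^(2^j) + (t + t^(2^j)) x^(2^i)] would be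
   bijective, and a preimage of [t^rho + t] would give three collinear points. *)
Lemma relative_norm_eq (t : F) :
  (t + t ^+ (2 ^ i)) ^+ E = (t + t ^+ (2 ^ j)) ^+ E.
Proof.
have [->|t0] := eqVneq t 0; first by rewrite !expr0n !eqn0Ngt !expn_gt0.
have [->|t1] := eqVneq t 1; first by rewrite !expr1n.
set c := t + _; set e := t + _; have [//|/eqP ce] := eqVneq (c ^+ E) (e ^+ E).
exfalso; pose h x : F := c * x ^+ (2 ^ j) + e * x ^+ (2 ^ i).
have h_inj : injective h.
  move=> x y hxy; apply/eqP; rewrite -addx_eq0; apply/eqP/eqP; rewrite -[_ == _]negbK.
  apply/negP => z0; apply: ce; set z := x + y in z0.
  (* [h] is additive, so a collision puts a nonzero z in its kernel; taking norms and cancelling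
     that of z^(2^i) makes the norms of c and e equal. *)
  have : c * z ^+ (2 ^ j) == e * z ^+ (2 ^ i).
    rewrite -addx_eq0 /z !frobD.
    by rewrite !mulrDr addrACA -/(h x) -/(h y) hxy addxx.
  move=> /eqP/(congr1 (fun u => u ^+ E)); rewrite !exprMn -!exprM expr_relative_norm.
  by apply: mulIf; rewrite expf_neq0.
have /codomP[x Ex] := injF_onto h_inj (t ^+ rho + t).
apply: (no_three_collinear x t t0 t1); apply/eqP; rewrite -addx_eq0.
rewrite !exprD !frobD !expr1n; move: Ex; rewrite /h /c /e exprD.
move: (x ^+ (2 ^ i)) (x ^+ (2 ^ j)) (t ^+ (2 ^ i)) (t ^+ (2 ^ j)) => A B a b Ex.
have -> : (A + a) * (B + b) + A * B + t * ((A + 1) * (B + 1) + A * B) =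
  ((a * b + t) + ((t + a) * B + (t + b) * A)) + (A * B + A * B) + t * (A * B + A * B).
  by ring.
by rewrite Ex !addxx mulr0 !addr0.
Qed.

Lemma digit_lt (a : 'I_n) : (d * a < m)%N.
Proof. by rewrite mulnC -ltn_divRL. Qed.

(* The monomials of the norm of [t + t^(2^k)] are indexed by the sets [J] of
   conjugates for which [t^(2^k)] is selected; their exponents have the binary
   digits [mixed_digit k J l]. *)
Definition mixed_digit (k : nat) (J : {set 'I_n}) (l : 'I_n) : 'I_m :=
  Ordinal (ltn_pmod (d * l + (l \in J) * k) m_gt0).

(** As d divides m, reduction modulo m preserves divisibility by d. Hence the digits of a monomial
    reveal which conjugates were selected. *)
Lemma dvd_mixed_digit (k : nat) (J : {set 'I_n}) (l : 'I_n) : ~~ (d %| k)%N ->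
  (d %| mixed_digit k J l)%N = (l \notin J).
Proof.
move=> dnk; rewrite /= /dvdn modn_dvdm // -/(dvdn _ _) (dvdn_addr _ (dvdn_mulr l (dvdnn d))).
by case: (l \in J); rewrite ?mul1n ?(negbTE dnk) ?mul0n ?dvdn0.
Qed.

Lemma mixed_digit_inj (k : nat) (J : {set 'I_n}) : ~~ (d %| k)%N ->
  injective (mixed_digit k J).
Proof.
move=> dnk l l' Ell'; have := dvd_mixed_digit k J l dnk.
rewrite Ell' dvd_mixed_digit // => /negb_inj EJ.
move/(congr1 val): Ell' => /= /eqP; rewrite EJ eqn_modDr.
have lt := digit_lt.
by rewrite !modn_small // eqn_mul2l eqn0Ngt d_gt0 => /eqP/val_inj.
Qed.

Lemma relative_degree_gt0 : (0 < n)%N. Proof. by rewrite divn_gt0 // dvdn_leq. Qed.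
Local Notation l0 := (Ordinal relative_degree_gt0).

Lemma not_dvd_j : ~~ (d %| j)%N.
Proof. by rewrite -(subnK (ltnW hij)) dvdn_addr. Qed.

(** The target digits are j and the d l with l nonzero. The multiples of d among them determine the
    complement of J, and the one remaining digit is k. *)
Lemma mixed_digit_imset_eq (k : nat) (J : {set 'I_n}) : ~~ (d %| k)%N -> (k < m)%N ->
  mixed_digit k J @: setT = mixed_digit j [set l0] @: setT -> J = [set l0] /\ k = j.
Proof.
move=> dnk km EJ; have dnj := not_dvd_j.
have lt := digit_lt.
have sJ : J = [set l0].
  apply/setP=> l; rewrite inE; apply/idP/eqP => [lJ|->].
    apply/eqP; apply: contraTT lJ => ll0.
    have : mixed_digit j [set l0] l \in mixed_digit k J @: setT.
      by rewrite EJ imset_f ?inE.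
    case/imsetP => l' _ E; have := dvd_mixed_digit k J l' dnk.
    rewrite -E dvd_mixed_digit // inE ll0 => /esym l'J.
    move/(congr1 val): E => /=; rewrite inE (negbTE ll0) (negbTE l'J) !mul0n !addn0.
    rewrite !modn_small // => /eqP; rewrite eqn_mul2l eqn0Ngt d_gt0 => /eqP/val_inj->.
    exact: l'J.
  apply: contraT => l0J; have : mixed_digit k J l0 \in mixed_digit j [set l0] @: setT.
    by rewrite -EJ imset_f ?inE.
  case/imsetP => l' _ E; have := dvd_mixed_digit j [set l0] l' dnj.
  rewrite -E dvd_mixed_digit // l0J inE => /esym l'0.
  move/(congr1 val): E => /=; rewrite inE (negbTE l'0) (negbTE l0J) muln0 !addn0.
  rewrite mod0n modn_small // => /esym/eqP; rewrite muln_eq0 eqn0Ngt d_gt0 /=.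
  by move=> l'00; case/eqP: l'0; apply/val_inj/eqP.
split=> //; have : mixed_digit k J l0 \in mixed_digit j [set l0] @: setT.
  by rewrite -EJ imset_f ?inE.
case/imsetP => l' _ E; have := dvd_mixed_digit j [set l0] l' dnj.
rewrite -E dvd_mixed_digit // sJ !inE eqxx => /esym/negbFE/eqP l'0.
by move/(congr1 val): E => /=; rewrite l'0 sJ inE eqxx !mul1n muln0 !add0n !modn_small.
Qed.

Local Notation T := (mixed_digit j [set l0] @: setT).

(** This is the coefficient of the monomial with digit set T in the norm of t + t^(2^k): after
    multiplication by the complementary monomial, only exponents divisible by 2^m - 1 survive
    summation. *)
Lemma power_sum_relative_norm (k : nat) : ~~ (d %| k)%N ->
  \sum_(t : F) t ^+ (binsum m (~: T)) * (t + t ^+ (2 ^ k)) ^+ E =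
  \sum_(J : {set 'I_n}) ((mixed_digit k J @: setT == T)%:R : F).
Proof.
move=> dnk; have dnj := not_dvd_j.
under eq_bigr => t _.
  have -> : (t + t ^+ (2 ^ k)) ^+ E = \prod_(l in [set: 'I_n])
      (t ^+ (2 ^ (d * l + k)) + t ^+ (2 ^ (d * l))).
    rewrite expr_sum; apply: eq_big => [l|l _]; first by rewrite inE.
    by rewrite frobD -exprM -expnD addrC addnC.
  over.
rewrite power_sum_prod; apply: eq_big => [J|J _]; first by rewrite subsetT.
rewrite power_sum; congr (_%:R); congr (nat_of_bool _).
set S := (\sum_(l in _) _)%N.
have S0 : (0 < S)%N.
  rewrite /S (bigD1 l0) ?inE //= addn_gt0.
  by case: (l0 \in J); rewrite expn_gt0.
have ES : S = binsum m (mixed_digit k J @: setT) %[mod N].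
  rewrite /binsum big_imset /=; last by move=> l l' _ _; apply: mixed_digit_inj.
  rewrite /S; elim/big_rec2: _ => // l a b _ E; rewrite -modnDm E modnDm.
  rewrite -[in RHS]modnDml -[in LHS]modnDml; congr ((_ + _) %% _)%N.
  have -> : (if l \in J then 2 ^ (d * l + k) else 2 ^ (d * l))%N =
     (2 ^ (d * l + (l \in J) * k))%N by case: (l \in J); rewrite ?mul1n ?addn0.
  by rewrite exp2_modn.
rewrite addn_gt0 S0 orbT /=.
rewrite /dvdn -modnDmr ES modnDmr -/(dvdn _ _).
have TT : T != setT.
  apply/eqP => TT; have : Ordinal m_gt0 \in T by rewrite TT inE.
  case/imsetP => l' _ E; have := dvd_mixed_digit j [set l0] l' dnj.
  rewrite -E dvdn0 inE => /esym l'0.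
  move/(congr1 val): E; rewrite /= inE (negbTE l'0) mul0n addn0 modn_small; last first.
    exact: digit_lt.
  by move/esym/eqP; rewrite muln_eq0 eqn0Ngt d_gt0 /= => l'00; case/eqP: l'0; apply/val_inj/eqP.
have T0 : T != set0 by apply/set0Pn; exists (mixed_digit j [set l0] l0); rewrite imset_f ?inE.
apply/idP/eqP => [dv|->]; last by rewrite addnC binsumC.
apply/esym/binsum_mod_inj => //; apply/eqP.
by rewrite -(eqn_modDl (binsum m (~: T))) addnC binsumC modnn eq_sym.
Qed.

(** The monomial of T occurs once in the norm for j and never in the norm for i, yet the two norms
    agree. *)
Lemma not_dvd_absurd : False.
Proof.
have S1 : \sum_(J : {set 'I_n}) ((mixed_digit j J @: setT == T)%:R : F) = 1.
  rewrite (bigD1 [set l0]) //= eqxx big1 ?addr0 // => J J0.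
  by case: eqP => // /(mixed_digit_imset_eq j J not_dvd_j hjm)[E _]; rewrite E eqxx in J0.
have S0 : \sum_(J : {set 'I_n}) ((mixed_digit i J @: setT == T)%:R : F) = 0.
  rewrite big1 // => J _.
  case: eqP => // /(mixed_digit_imset_eq i J di (ltn_trans hij hjm))[_ E].
  by move: hij; rewrite -E ltnn.
move: S0 S1; rewrite -!power_sum_relative_norm ?not_dvd_j //.
under eq_bigr do rewrite relative_norm_eq.
by move=> -> /eqP; rewrite eq_sym oner_eq0.
Qed.

End NotDividing.

(** * The case d dividing i and j: minimal closed sets and Glynn's criterion *)

Section Dividing.
Variable d : nat.
Hypotheses (d_gt1 : (1 < d)%N) (dm : (d %| m)%N) (di : (d %| i)%N) (dj : (d %| j)%N).

Local Notation rot := (rot_digit m m_gt0).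

Definition pred_closed (R : {set 'I_m}) : bool :=
  [&& R != set0, R \subset [set l : 'I_m | (d %| l)%N] &
      [forall l in R, [exists u in R, (rot i u == l) || (rot j u == l)]]].

Lemma dvd_rot (k : nat) (l : 'I_m) : (d %| rot k l)%N = (d %| l + k)%N.
Proof. by rewrite /= /dvdn modn_dvdm. Qed.

Lemma pred_closed_multiples : pred_closed [set l : 'I_m | (d %| l)%N].
Proof.
apply/and3P; split=> //.
  by apply/set0Pn; exists (Ordinal m_gt0); rewrite inE.
apply/forall_inP => l; rewrite inE => dl; apply/exists_inP.
have /codomP[u Eu] := injF_onto (rot_digit_inj m m_gt0 i) l.
exists u; last by rewrite -Eu eqxx.
by move: dl; rewrite Eu dvd_rot dvdn_addl // inE.
Qed.

(* Any choice of predecessors inside a minimal set is a bijection of that set: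
   its image is again closed. *)
Lemma pred_closed_minset_uniq (R : {set 'I_m}) (l u v : 'I_m) :
  minset pred_closed R -> l \in R -> u \in R -> v \in R ->
  (rot i u == l) || (rot j u == l) -> (rot i v == l) || (rot j v == l) -> u = v.
Proof.
case/minsetP => /and3P[R0 RM /forall_inP Rpred] Rmin lR uR vR ul vl.
have [//|uv] := eqVneq u v; exfalso.
pose P u l := (rot i u == l) || (rot j u == l).
have surj (q : 'I_m -> 'I_m) : (forall x, x \in R -> q x \in R) ->
    (forall x, x \in R -> P (q x) x) -> q @: R = R.
  move=> qR qP; have qRR : q @: R \subset R.
    by apply/subsetP => _ /imsetP[x xR ->]; apply: qR.
  apply: Rmin (qRR); apply/and3P; split.
  - by rewrite imset_eq0.
  - exact: subset_trans qRR RM.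
  - apply/forall_inP => x xq; have xR := subsetP qRR _ xq.
    by apply/exists_inP; exists (q x); [exact: imset_f | exact: qP].
pose p x := odflt x [pick y in R | P y x].
have pP x : x \in R -> p x \in R /\ P (p x) x.
  move=> xR; rewrite /p; case: pickP => [y /andP[]//|no].
  by have /exists_inP[y yR yx] := Rpred x xR; have := no y; rewrite /= yR /P yx.
pose pw w x := if x == l then w else p x.
have pwR w : w \in R -> P w l -> pw w @: R = R.
  move=> wR wl; apply: surj => x xR; rewrite /pw.
    by case: eqP => // _; case: (pP x xR).
  by case: eqP => [->//|_]; case: (pP x xR).
(* [pw u] attains v at some x other than l, where it agrees with [pw v]; so [pw v] takes the value v
   at both x and l, against its injectivity on R. *)
have /imsetP[x xR] : v \in pw u @: R by rewrite pwR.
rewrite /pw; case: (eqVneq x l) => [_ E|xl E]; first by rewrite E eqxx in uv.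
have /imset_injP inj : #|pw v @: R| == #|R| by rewrite pwR.
by have := inj x l xR lR; rewrite /pw (negbTE xl) eqxx -E => /(_ erefl)/eqP; rewrite (negbTE xl).
Qed.

Lemma sum_even_fibers (h : F -> F) : \sum_(x : F) h (Gamma rho x) = 0.
Proof.
rewrite (partition_big (@Gamma F rho) predT) //= big1 // => y _.
rewrite (eq_bigr (fun=> h y)) => [|x /eqP->//].
rewrite sumr_const; have -> : #|[pred x | Gamma rho x == y]| =
   #|[set x | Gamma rho x == y]| by rewrite cardsE.
by have := h21 y; rewrite !inE => /orP[] /eqP ->; rewrite ?mulr0n ?mulr2n ?addxx.
Qed.

(** Injectivity of x^(rho-1), read on powers of a primitive element, makes rho - 1 cancellable. *)
Lemma expr_rho_pred_modn (a b : nat) :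
  ((rho - 1) * a = (rho - 1) * b %[mod N])%N -> (a = b %[mod N])%N.
Proof.
move=> E; have [g pg] := prim_root_exists.
apply/eqP; rewrite -(eq_prim_root_expr pg); apply/eqP/expr_rho_pred_inj.
rewrite -!exprM ![(_ * (rho - 1))%N]mulnC.
by apply: expr_modn E; apply: prim_expr_order.
Qed.

(* A set [R] of binary digits whose value [r] satisfies [r (rho - 1) = l] modulo
   [2^m - 1] with [l] and [r] having no digit in common contradicts
   2-to-1-ness (this is Glynn's criterion for monomial hyperovals). *)
Lemma Glynn_criterion (R L : {set 'I_m}) : R != set0 -> R != setT -> [disjoint R & L] ->
  (binsum m R + binsum m L = rho * binsum m R %[mod N])%N -> False.
Proof.
move=> R0 RT RL E; pose K := ~: L.
have RK : R \subset K by rewrite -disjoints_subset.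
(* The power of Gamma(x) with digit set K sums to 0. In its expansion the term of J has exponent
   (rho - 1) [binsum m J] + [binsum m K]; among subsets of K only J = R makes this divisible by 2^m
   - 1, so the sum would also be 1. *)
have := sum_even_fibers (fun y => y ^+ 0 * \prod_(l in K) y ^+ (2 ^ l)).
under eq_bigr => x _.
  have -> : Gamma rho x ^+ 0 * \prod_(l in K) Gamma rho x ^+ (2 ^ l) =
    x ^+ 0 * \prod_(l in K) (x ^+ (rho * 2 ^ l) + x ^+ (2 ^ l)).
    by rewrite !expr0; congr (_ * _); apply: eq_bigr => l _; rewrite frobD exprM.
  over.
rewrite power_sum_prod (bigD1 R) //=.
have sumE (J : {set 'I_m}) : J \subset K ->
    (0 + \sum_(l in K) (if l \in J then rho * 2 ^ l else 2 ^ l) =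
     (rho - 1) * binsum m J + binsum m K)%N.
  move=> JK; rewrite add0n /binsum [LHS](bigID (mem J)) /=.
  rewrite [(\sum_(l in K) 2 ^ l)%N](bigID (mem J)) /=.
  have -> (G : 'I_m -> nat) : (\sum_(l in K | l \in J) G l = \sum_(l in J) G l)%N.
    by apply: eq_bigl => l; apply: andb_idl; apply: (subsetP JK).
  have -> (G : 'I_m -> nat) : (\sum_(l in K | l \in J) G l = \sum_(l in J) G l)%N.
    by apply: eq_bigl => l; apply: andb_idl; apply: (subsetP JK).
  rewrite addnA -mulSnr -subSn ?(ltnW rho_gt1) // subn1 /= big_distrr /=.
  congr (_ + _)%N; apply: eq_bigr => l; first by move->.
  by case/andP => _ /negbTE->.
have dvdE (J : {set 'I_m}) : J \subset K ->
    (N %| (rho - 1) * binsum m J + binsum m K)%N = (J == R).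
  move=> JK; have EKL : (binsum m K + binsum m L = N)%N by rewrite addnC binsumC.
  have E1 : ((rho - 1) * binsum m R = binsum m L %[mod N])%N.
    apply/eqP; rewrite -(eqn_modDl (binsum m R)) -mulSn -subSn ?(ltnW rho_gt1) // subn1 /=.
    by rewrite E.
  rewrite /dvdn -[X in _ == X](mod0n N) -(eqn_modDr (binsum m L)) add0n -addnA EKL modnDr.
  rewrite -E1; apply/eqP/eqP => [/expr_rho_pred_modn/esym/binsum_mod_inj|->//].
  by move=> ->.
rewrite [X in X + _]power_sum sumE // dvdE // eqxx andbT.
rewrite addn_gt0 (binsum_gt0 m K) ?orbT; last first.
  by apply: contraNneq R0 => K0; rewrite K0 subset0 in RK.
rewrite big1 ?addr0; first by move/eqP; rewrite oner_eq0.
by move=> J /andP[JK JR]; rewrite power_sum sumE // dvdE // (negbTE JR) andbF.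
Qed.

(** Modulo 2^m - 1, rho times the value of R is the sum of the values of R + i and R + j. Their
    common digits I carry one place up, to positions that are 1 modulo d and hence outside R. The
    union without I contains R, and its remainder and the carries form the set required by
    [Glynn_criterion]. *)
Lemma dvd_absurd : False.
Proof.
have [R Rmin _] := minset_exists pred_closed_multiples.
have uniq l u v := pred_closed_minset_uniq R l u v Rmin.
have /and3P[R0 /subsetP RM /forall_inP Rpred] := minsetp Rmin.
have dvdR l : l \in R -> (d %| l)%N by move/RM; rewrite inE.
pose Ri := rot i @: R; pose Rj := rot j @: R.
pose I := Ri :&: Rj; pose L1 := (Ri :|: Rj) :\: I :\: R; pose L2 := rot 1 @: I.
have dvdI l : l \in I -> (d %| l)%N.
  by case/setIP => /imsetP[u uR ->] _; rewrite dvd_rot dvdn_addr ?dvdR.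
have dvdL2 l : l \in L2 -> ~~ (d %| l)%N.
  case/imsetP => u uI ->; rewrite dvd_rot dvdn_addr ?dvdI //.
  by rewrite dvdn1 gtn_eqF.
have dvdL1 l : l \in L1 -> (d %| l)%N.
  by case/setDP => /setDP[/setUP[] /imsetP[u uR ->] _ _]; rewrite dvd_rot dvdn_addr ?dvdR.
(* Otherwise l - i and l - j would both lie in R; uniqueness of the predecessor would then force i =
   j. *)
have RI l : l \in R -> l \notin I.
  move=> lR; apply/negP => /setIP[/imsetP[u uR Eu] /imsetP[v vR Ev]].
  have Euv : u = v by apply: (uniq l) => //; rewrite ?Eu ?eqxx // -Eu Ev eqxx orbT.
  move/(congr1 val): Ev => /=; rewrite Eu -Euv /= => /eqP; rewrite eqn_modDl.
  by rewrite !modn_small ?(ltn_trans hij) // => /eqP Eij; move: hij; rewrite Eij ltnn.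
have RU l : l \in R -> l \in Ri :|: Rj.
  move=> lR; have /exists_inP[u uR /orP[]/eqP<-] := Rpred l lR.
    by rewrite inE imset_f.
  by rewrite inE imset_f ?orbT.
have disj12 : [disjoint L1 & L2].
  rewrite -setI_eq0; apply/eqP/setP => l; rewrite in_setI in_set0; apply/negP => /andP[].
  by move=> /dvdL1 dl /dvdL2; rewrite dl.
apply: (Glynn_criterion R (L1 :|: L2)) => //.
- apply/eqP => RT; have lt1m : (1 < m)%N := leq_trans d_gt1 (dvdn_leq m_gt0 dm).
  by have := dvdR (Ordinal lt1m); rewrite RT inE dvdn1 gtn_eqF // => /(_ isT).
- rewrite -setI_eq0; apply/eqP/setP => l; rewrite in_setI in_setU in_set0; apply/negP => /andP[lR].
  by case/orP => [/setDP[_]|/dvdL2]; rewrite ?lR ?dvdR.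
rewrite binsumU // addnA mulnDl.
have -> : (binsum m R + binsum m L1 = binsum m ((Ri :|: Rj) :\: I))%N.
  rewrite -binsumU; last by rewrite -setI_eq0; apply/eqP/setP => l; rewrite !inE; case: (l \in R).
  congr binsum; apply/setP => l; rewrite [in LHS]inE [l \in L1]inE.
  by case lR: (l \in R) => //=; rewrite inE RI ?RU.
have EU : (binsum m (Ri :|: Rj) + binsum m I = binsum m Ri + binsum m Rj)%N.
  have -> : Ri :|: Rj = Ri :|: (Rj :\: Ri) by apply/setP => l; rewrite !inE; case: (l \in Ri).
  rewrite binsumU; last by rewrite -setI_eq0; apply/eqP/setP => l; rewrite !inE; case: (l \in Ri).
  rewrite -addnA; congr (_ + _)%N; rewrite addnC -binsumU.
    congr binsum; apply/setP => l; rewrite !inE; by case: (l \in Ri); case: (l \in Rj).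
  by rewrite -setI_eq0; apply/eqP/setP => l; rewrite !inE; case: (l \in Ri); case: (l \in Rj).
have ED : (binsum m ((Ri :|: Rj) :\: I) + binsum m I = binsum m (Ri :|: Rj))%N.
  rewrite -binsumU; last by rewrite -setI_eq0; apply/eqP/setP => l; rewrite !inE; case: (l \in Ri); case: (l \in Rj).
  by congr binsum; apply/setP => l; rewrite !inE; case: (l \in Ri); case: (l \in Rj).
rewrite -modnDmr binsum_rot modnDmr expn1 mul2n -addnn addnA ED EU.
by rewrite -modnDm !binsum_rot modnDm.
Qed.

End Dividing.

Lemma coprime_m_diff : coprime m (j - i).
Proof.
set d := gcdn m (j - i); have dm : (d %| m)%N := dvdn_gcdl _ _.
have dk : (d %| j - i)%N := dvdn_gcdr _ _.
have d0 : (0 < d)%N by rewrite gcdn_gt0 m_gt0.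
have [di|di] := boolP (d %| i)%N; last first.
  by case: (not_dvd_absurd d d0 dm dk di).
have dj : (d %| j)%N by rewrite -(subnK (ltnW hij)) dvdn_addr.
have [d1|d1] := ltnP 1 d; first by case: (dvd_absurd d d1 dm di dj).
by rewrite /coprime -/d eqn_leq d1 d0.
Qed.

(** * Quadratic exponential sums *)

Local Notation Tr := (@absTr F m).

Lemma absTrD (x y : F) : Tr (x + y) = Tr x + Tr y.
Proof. by rewrite /absTr -big_split /=; apply: eq_bigr => k _; rewrite frobD. Qed.

Lemma absTr0 : Tr 0 = 0.
Proof. by apply: (addrI (Tr 0)); rewrite -absTrD !addr0. Qed.

Lemma absTr_sqr (x : F) : Tr (x ^+ 2) = Tr x.
Proof.
rewrite /absTr; case: m m_gt0 hF => // m' _ hF'.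
rewrite big_ord_recr big_ord_recl /= -exprM -expnS -hF' expf_card addrC expr1.
by congr (_ + _); apply: eq_bigr => k _; rewrite -exprM -expnS.
Qed.

Lemma absTr_frob (k : nat) (x : F) : Tr (x ^+ (2 ^ k)) = Tr x.
Proof. by elim: k => [|k IH]; rewrite ?expr1 // expnSr exprM absTr_sqr. Qed.

Lemma absTr01 (x : F) : Tr x = 0 \/ Tr x = 1.
Proof.
have E : Tr x ^+ 2 = Tr x.
  rewrite -[in RHS]absTr_sqr /absTr.
  elim/big_rec2: _ => [|k a b _ <-]; first by rewrite expr0n.
  by rewrite -[2%N]/(2 ^ 1)%N frobD exprAC.
have : Tr x * (Tr x - 1) == 0 by rewrite mulrBr mulr1 -expr2 E subrr.
by rewrite mulf_eq0 subr_eq0 => /orP[] /eqP; [left | right].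
Qed.

(** If the trace vanished, so would the sum of x^(2^m-2) Tr(x). But the term k = 0 has exponent 2^m
    - 1 and sums to 1, while for k > 0 the exponent lies strictly between 2^m - 1 and its double. *)
Lemma absTr_neq0 : exists x : F, Tr x != 0.
Proof.
apply/existsP; rewrite -[X in is_true X]negbK negb_exists; apply/negP => /forallP T0.
have : \sum_(x : F) x ^+ (N - 1) * Tr x = 0.
  by rewrite big1 // => x _; move: (T0 x); rewrite negbK => /eqP->; rewrite mulr0.
under eq_bigr do rewrite mulr_sumr; rewrite exchange_big /=.
rewrite (bigD1 (Ordinal m_gt0)) //= [X in _ + X]big1 ?addr0 => [|k k0].
  under eq_bigr do rewrite -exprD.
  by rewrite power_sum subnK ?card_gt1 // dvdnn /= => /eqP; rewrite oner_eq0.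
under eq_bigr do rewrite -exprD.
rewrite power_sum; have k1 : (0 < k)%N.
  by rewrite lt0n; apply: contra_neq k0 => k0; apply/val_inj.
have lo : (1 < 2 ^ k)%N by rewrite -{1}(expn0 2) ltn_exp2l.
have hi : (2 ^ k < 2 ^ m)%N by rewrite ltn_exp2l.
have -> : (N - 1 + 2 ^ k = N + (2 ^ k - 1))%N by have := card_gt1; lia.
rewrite dvdn_addr // gtnNdvd ?andbF //; lia.
Qed.


Definition chi (x : F) : int := if Tr x == 0 then 1 else -1.

Lemma chiE (x : F) : chi x = 1 - 2 * (Tr x != 0)%:R.
Proof. by rewrite /chi; case: eqP. Qed.

Lemma chi0 : chi 0 = 1.
Proof. by rewrite /chi absTr0 eqxx. Qed.

Lemma chiD (x y : F) : chi (x + y) = chi x * chi y.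
Proof.
rewrite /chi absTrD.
case: (absTr01 x) => ->; case: (absTr01 y) => ->;
  by rewrite ?addxx ?addr0 ?add0r ?eqxx ?oner_eq0.
Qed.

(** For nonzero a, translating x by u / a with Tr(u) nonzero changes the sign of the sum. *)
Lemma chi_sum (a : F) : \sum_(x : F) chi (a * x) = (2 ^ m)%N%:R * (a == 0)%:R.
Proof.
have [->|a0] := eqVneq a 0.
  under eq_bigr do rewrite mul0r chi0.
  by rewrite sumr_const mulr1 cardT -cardE hF.
have [u u0] := absTr_neq0; rewrite mulr0; set S := \sum_x _.
have : S = chi u * S.
  rewrite {1}/S (reindex_inj (addrI (u / a))) /= mulr_sumr.
  by apply: eq_bigr => x _; rewrite mulrDr mulrC divfK // chiD.
by rewrite {1}/chi (negbTE u0); lia.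
Qed.

(** Bezout over the naturals: q b = gcd + c a, and u is fixed by the powers 2^(q b) and 2^(c a). *)
Lemma frob_fix_gcd (a b : nat) (u : F) : (0 < b)%N ->
  u ^+ (2 ^ a) = u -> u ^+ (2 ^ b) = u -> u ^+ (2 ^ gcdn b a) = u.
Proof.
move=> b0 ua ub.
have mult c q : u ^+ (2 ^ c) = u -> u ^+ (2 ^ (q * c)) = u.
  by move=> uc; elim: q => [|q IH]; rewrite ?expr1 // mulSn expnD exprM uc.
have [c _ /dvdnP[q Eq]] := Bezoutl a b0.
have := mult b q ub; rewrite -Eq addnC expnD exprM mult //.
Qed.

(** With kappa = j - i, Frobenius invariance of the trace leaves a character linear in y with
    coefficient u^(2^(m-kappa)) + u^(2^kappa). It vanishes only if u^(2^(2 kappa)) = u, and gcd(m, 2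
    kappa) = 1 for odd m. *)
Lemma chi_bilinear_sum (u : F) : odd m ->
  \sum_(y : F) chi (u ^+ (2 ^ i) * y ^+ (2 ^ j) + u ^+ (2 ^ j) * y ^+ (2 ^ i)) =
  (2 ^ m)%N%:R * ((u == 0) || (u == 1))%:R.
Proof.
move=> m_odd; have km : (j - i <= m)%N by rewrite (leq_trans (leq_subr _ _)) // ltnW.
have um : u ^+ (2 ^ m) = u by rewrite -hF expf_card.
transitivity (\sum_(y : F) chi ((u ^+ (2 ^ (m - (j - i))) + u ^+ (2 ^ (j - i))) * y)).
  apply: eq_bigr => y _; rewrite mulrDl !chiD; congr (_ * _); rewrite /chi.
    rewrite -[in RHS](absTr_frob j) exprMn -exprM -expnD.
    have -> : (m - (j - i) + j = m + i)%N by lia.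
    by rewrite expnD exprM um.
  rewrite -[in RHS](absTr_frob i) exprMn -exprM -expnD.
  by rewrite subnK // ltnW.
rewrite chi_sum addx_eq0; congr (_ * (nat_of_bool _)%:R).
apply/eqP/orP => [E|]; last by case=> /eqP ->; rewrite ?expr0n ?expr1n ?eqn0Ngt ?expn_gt0.
have u2 : u ^+ (2 ^ (2 * (j - i))) = u.
  by rewrite mul2n -addnn expnD exprM -E -exprM -expnD subnK.
have := frob_fix_gcd _ _ u m_gt0 u2 um.
have -> : gcdn m (2 * (j - i)) = 1%N.
  by apply/eqP; rewrite -/(coprime _ _) coprimeMr coprime_m_diff coprimen2 m_odd.
move=> /eqP; rewrite -subr_eq0 expr2 -{3}[u]mulr1 -mulrBr mulf_eq0 subr_eq0.
by case/orP => ->; [left | right].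
Qed.

Definition quad_sum (b : F) : int := \sum_(y : F) chi (y ^+ rho + b * y).

(** Replacing the second variable by y + u leaves the character of the polar form to be summed over
    y; only u = 0 and u = 1 survive. *)
Lemma quad_sum_sqr (b : F) : odd m ->
  quad_sum b ^+ 2 = (2 ^ m)%N%:R * (1 + chi (1 + b)).
Proof.
move=> m_odd; rewrite expr2 /quad_sum big_distrlr /=.
transitivity (\sum_(u : F) chi (u ^+ rho + b * u) *
  \sum_(y : F) chi (u ^+ (2 ^ i) * y ^+ (2 ^ j) + u ^+ (2 ^ j) * y ^+ (2 ^ i))).
  under [RHS]eq_bigr do rewrite mulr_sumr.
  rewrite [RHS]exchange_big /=; apply: eq_bigr => y _.
  rewrite (reindex_inj (addrI y)) /=; apply: eq_bigr => u _.
  rewrite -!chiD !exprD !frobD; congr chi.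
  move: (y ^+ (2 ^ i)) (y ^+ (2 ^ j)) (u ^+ (2 ^ i)) (u ^+ (2 ^ j)) => A B a c.
  have -> : A * B + b * y + ((A + a) * (B + c) + b * (y + u)) =
     (a * c + b * u + (a * B + c * A)) + ((A * B + b * y) + (A * B + b * y)) by ring.
  by rewrite addxx addr0.
under eq_bigr do rewrite chi_bilinear_sum //.
rewrite (bigD1 0) //= (bigD1 1) ?oner_neq0 //= big1 => [|u /andP[u0 u1]]; last first.
  by rewrite (negbTE u0) (negbTE u1) !mulr0.
rewrite !eqxx orbT expr0n gtn_eqF ?addn_gt0 ?expn_gt0 // mulr0 addr0 chi0 expr1n mulr1.
by rewrite addr0 !mulr1 -mulrDl mulrC.
Qed.

(** * Walsh sums of Gamma, their moments and the weights *)

Definition Walsh (c : F) : int := \sum_(x : F) chi (c * Gamma rho x).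

Lemma Walsh_sqr (c : F) : odd m -> c != 0 ->
  Walsh c ^+ 2 = 0 \/ Walsh c ^+ 2 = (2 ^ m.+1)%N%:R.
Proof.
move=> m_odd c0; have /codomP[e Ee] := injF_onto expr_rho_inj c.
have e0 : e != 0.
  by apply: contra_neq c0 => e0; rewrite Ee e0 expr0n gtn_eqF // ltnW // rho_gt1.
have -> : Walsh c = quad_sum (c / e).
  rewrite /Walsh /quad_sum; rewrite [LHS](reindex_inj (mulIf (invr_neq0 e0))) /=.
  apply: eq_bigr => y _; congr chi; rewrite /Gamma mulrDr exprMn exprVn -Ee.
  by congr (_ + _); [rewrite mulrCA divff ?mulr1 | rewrite mulrA mulrAC].
rewrite quad_sum_sqr // /chi; case: eqP => _; [right | left]; last by rewrite subrr mulr0.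
by rewrite expnS mulnC natrM.
Qed.

Lemma card_Gamma_fiber (x : F) : #|[pred y | Gamma rho y == Gamma rho x]| = 2%N.
Proof.
set A := [pred y | _]; have A0 : (0 < #|A|)%N by apply/card_gt0P; exists x; rewrite inE.
have := h21 (Gamma rho x); have -> : #|[set y | Gamma rho y == Gamma rho x]| = #|A|.
  by rewrite cardsE; apply: eq_card.
by move: #|A| A0 => [|[|[|k]]].
Qed.

Lemma sum_Gamma_fiber (x : F) : (\sum_y (Gamma rho y == Gamma rho x) = 2)%N.
Proof.
transitivity #|[pred y | Gamma rho y == Gamma rho x]|; last exact: card_Gamma_fiber.
by rewrite -sum1_card [RHS]big_mkcond; apply: eq_bigr => y _; rewrite inE; case: eqP.
Qed.

Lemma Gamma0 : Gamma rho (0 : F) = 0.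
Proof. by rewrite /Gamma expr0n gtn_eqF ?addr0 // ltnW // rho_gt1. Qed.

Lemma Gamma_imset0 : 0 \in [set Gamma rho x | x in F].
Proof. by apply/imsetP; exists 0; rewrite ?Gamma0. Qed.

Lemma sum_Walsh : \sum_(c : F) Walsh c = (2 ^ m * 2)%N%:R.
Proof.
rewrite /Walsh exchange_big /=; under eq_bigr do under eq_bigr do rewrite mulrC.
under eq_bigr do rewrite chi_sum.
rewrite -mulr_sumr natrM -natr_sum; congr (_ * _%:R).
by have := sum_Gamma_fiber 0; rewrite Gamma0.
Qed.

(** Orthogonality counts the pairs (x, y) with Gamma(x) = Gamma(y); each x has two partners, itself
    included. *)
Lemma sum_Walsh_sqr : \sum_(c : F) Walsh c ^+ 2 = (2 ^ m * (2 ^ m * 2))%N%:R.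
Proof.
transitivity (\sum_(c : F) \sum_(x : F) \sum_(y : F) chi ((Gamma rho y + Gamma rho x) * c)).
  apply: eq_bigr => c _; rewrite expr2 /Walsh big_distrlr /=.
  apply: eq_bigr => x _; apply: eq_bigr => y _.
  by rewrite -chiD -mulrDr mulrC addrC.
rewrite exchange_big /=; under eq_bigr do rewrite exchange_big /=.
under eq_bigr do under eq_bigr do rewrite chi_sum addx_eq0.
under eq_bigr => x _.
  rewrite -mulr_sumr -natr_sum.
  rewrite sum_Gamma_fiber; over.
by rewrite sumr_const cardT -cardE hF !natrM [RHS]mulr_natl.
Qed.

Lemma Gamma_imset_type :
  [set Gamma rho x | x : F] = [set Gamma rho x | x in F] :> {set F}.
Proof. by apply/setP => y; apply/imsetP/imsetP => -[x _ ->]; exists x. Qed.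

Lemma card_DGamma : #|DGamma F rho| = (2 ^ (m - 1) - 1)%N.
Proof.
have im0 := Gamma_imset0.
have : (\sum_(x in F) 1 = 2 ^ m)%N by rewrite sum1_card.
rewrite (partition_big_imset (Gamma rho)) /= Gamma_imset_type.
rewrite (eq_bigr (fun=> 2%N)) => [|y /imsetP[x _ ->]]; last first.
  rewrite sum1_card; apply: etrans (card_Gamma_fiber x).
  by apply: eq_card => z; rewrite !inE.
rewrite sum_nat_const => E; have := cardsD1 0 [set Gamma rho x | x in F].
rewrite im0 -/(DGamma F rho) => E1.
have Em : (2 ^ m = 2 * 2 ^ (m - 1))%N by rewrite -expnS subn1 prednK.
have arith (a b : nat) : (a * 2 = 2 ^ m)%N -> (a = true + b)%N -> b = (2 ^ (m - 1) - 1)%N.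
  by rewrite Em; lia.
exact: arith E E1.
Qed.

(** Each point of the image is hit twice: 0 contributes 2, and a nonzero y contributes 2 or -2
    according to the coordinate Tr(c y). *)
Lemma Walsh_wt (c : F) :
  Walsh c = (2 ^ m)%N%:R - 4 * (wt (codeword m (DGamma F rho) c))%:R.
Proof.
pose D := DGamma F rho.
have -> : wt (codeword m D c) = (\sum_(y in D) (Tr (c * y)%R != 0%R))%N.
  rewrite /wt -sum1_card [RHS]big_enum_val [LHS]big_mkcond /=; apply: eq_bigr => k _.
  by rewrite inE ffunE; case: eqP.
have im0 := Gamma_imset0.
rewrite /Walsh (partition_big_imset (Gamma rho)) /= Gamma_imset_type.
transitivity (\sum_(y in [set Gamma rho x | x in F]) 2 * chi (c * y)).
  apply: eq_bigr => y /imsetP[x _ ->]; rewrite (eq_bigr (fun=> chi (c * Gamma rho x))).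
    by rewrite sumr_const card_Gamma_fiber mulr_natl.
  by move=> z /eqP ->.
rewrite (big_setD1 0) //= mulr0 chi0 mulr1 -/(DGamma F rho) -/D.
rewrite -mulr_sumr (eq_bigr (fun y => 1 - 2 * (Tr (c * y) != 0)%:R)) => [|y _]; last exact: chiE.
rewrite sumrB sumr_const -mulr_sumr -natr_sum card_DGamma.
set s := (\sum_(y in _) _)%N.
have : (2 ^ m = 2 * 2 ^ (m - 1))%N by rewrite -expnS subn1 prednK.
by have := expn_gt0 2 (m - 1); lia.
Qed.

(** * The weight distribution *)

Section WeightDistribution.
Variable e : nat.
Hypothesis me : m = (2 * e + 3)%N.

Local Notation p := (2 ^ e)%N.
Local Notation D := (DGamma F rho).
Local Notation weight x := (wt (codeword m D x)).

Lemma exp2m : (2 ^ m = 8 * (p * p))%N.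
Proof. by rewrite me addnC expnD mul2n -addnn expnD. Qed.

Lemma odd_m : odd m.
Proof. by rewrite me oddD mul2n odd_double. Qed.

Lemma codeword0 : codeword m D 0 = 0.
Proof. by apply/ffunP => k; rewrite !ffunE mul0r absTr0. Qed.

Lemma weight0 : weight 0 = 0%N.
Proof. by rewrite codeword0 wt0. Qed.

Lemma weight_values (x : F) : x != 0 ->
  [\/ weight x = (2 * (p * p) - p)%N /\ Walsh x = (4 * p)%N%:R,
      weight x = (2 * (p * p))%N /\ Walsh x = 0 |
      weight x = (2 * (p * p) + p)%N /\ Walsh x = - (4 * p)%N%:R].
Proof.
move=> x0; have W := Walsh_wt x; rewrite exp2m in W.
have pp : (p <= p * p)%N by rewrite leq_pmulr ?expn_gt0.
have [/eqP E|] := Walsh_sqr x odd_m x0.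
  rewrite expf_eq0 /= in E; apply: Or32; move/eqP: E => E; split=> //.
  by move: W; rewrite E; lia.
have -> : (2 ^ m.+1)%N%:R = (4 * p)%N%:R ^+ 2 :> int.
  by rewrite expnS exp2m -natrX; congr (_%:R); lia.
move/eqP; rewrite eqf_sqr => /orP[] /eqP E; [apply: Or31 | apply: Or33]; split=> //;
  by move: W; rewrite E; lia.
Qed.

Lemma weights_lt (P q : nat) : (0 < q)%N -> (q <= P)%N ->
  [/\ (0 < 2 * P - q)%N, (2 * P - q < 2 * P)%N & (2 * P < 2 * P + q)%N].
Proof. by move=> q0 qP; split; lia. Qed.

(** Summed over x, these identities turn the moments of W into linear equations for the weight
    counts. The word of x = 0 stands apart because 2 p^2 - p > 0. *)
Lemma weight_indicators (x : F) :
  [/\ Walsh x = (x == 0)%:R * (2 ^ m)%N%:R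
        + (4 * p)%N%:R * (weight x == 2 * (p * p) - p)%N%:R
        - (4 * p)%N%:R * (weight x == 2 * (p * p) + p)%N%:R,
      Walsh x ^+ 2 = (x == 0)%:R * (2 ^ m * 2 ^ m)%N%:R
        + (2 ^ m * 2)%N%:R * (weight x == 2 * (p * p) - p)%N%:R
        + (2 ^ m * 2)%N%:R * (weight x == 2 * (p * p) + p)%N%:R &
      1%R = (x == 0%R)%:R + (weight x == 2 * (p * p) - p)%N%:R
        + (weight x == 2 * (p * p))%N%:R + (weight x == 2 * (p * p) + p)%N%:R :> int].
Proof.
have pp : (p <= p * p)%N by rewrite leq_pmulr ?expn_gt0.
have [h1 h2 h3] := weights_lt (p * p) p (expn_gt0 2 e) pp.
have EW : (2 ^ m * 2)%N%:R = (4 * p)%N%:R ^+ 2 :> int.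
  by rewrite exp2m -natrX; congr (_%:R); lia.
have [->|x0] := eqVneq x 0.
  have -> : Walsh 0 = (2 ^ m)%N%:R by rewrite Walsh_wt weight0 mulr0 subr0.
  rewrite weight0 (ltn_eqF h1) (ltn_eqF (ltn_trans h1 h2)).
  rewrite (ltn_eqF (ltn_trans h1 (ltn_trans h2 h3))) /= mulr0n mulr1n.
  by rewrite !mulr0 !addr0 !mul1r expr2 natrM.
have [[-> ->]|[-> ->]|[-> ->]] := weight_values x x0.
- rewrite eqxx (ltn_eqF h2) (ltn_eqF (ltn_trans h2 h3)) /= mulr0n mulr1n.
  by rewrite EW !mulr0 !mul0r !addr0 !add0r !mulr1.
- rewrite eqxx (gtn_eqF h2) (ltn_eqF h3) /= mulr0n mulr1n.
  by rewrite !mulr0 !mul0r !addr0 !add0r expr0n.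
- rewrite eqxx (gtn_eqF h3) (gtn_eqF (ltn_trans h2 h3)) /= mulr0n mulr1n.
  by rewrite EW !mulr0 !mul0r !add0r !mulr1 sqrrN.
Qed.

Lemma weight_counts :
  [/\ #|[set x | (weight x == 2 * (p * p) - p)%N]| = (2 * (p * p) + p)%N,
      #|[set x | (weight x == 2 * (p * p))%N]| = (4 * (p * p) - 1)%N &
      #|[set x | (weight x == 2 * (p * p) + p)%N]| = (2 * (p * p) - p)%N].
Proof.
have sumind (P : pred F) : \sum_x (P x)%:R = #|[set x | P x]|%:R :> int.
  rewrite -natr_sum; congr (_%:R); rewrite -sum1_card [RHS]big_mkcond.
  by apply: eq_bigr => x _; rewrite inE; case: (P x).
have sum0 : \sum_(x : F) (x == 0%R)%:R = 1%R :> int.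
  rewrite (sumind (pred1 0)) (_ : #|_| = 1%N) //; apply: etrans (cards1 (0 : F)).
  by apply: eq_card => x; rewrite !inE.
pose lo x := (weight x == 2 * (p * p) - p)%N; pose mid x := (weight x == 2 * (p * p))%N.
pose hi x := (weight x == 2 * (p * p) + p)%N.
have : \sum_(x : F) Walsh x = \sum_(x : F) ((x == 0%R)%:R * (2 ^ m)%N%:R
    + (4 * p)%N%:R * (lo x)%:R - (4 * p)%N%:R * (hi x)%:R).
  by apply: eq_bigr => x _; case: (weight_indicators x).
have : \sum_(x : F) Walsh x ^+ 2 = \sum_(x : F) ((x == 0%R)%:R * (2 ^ m * 2 ^ m)%N%:R
    + (2 ^ m * 2)%N%:R * (lo x)%:R + (2 ^ m * 2)%N%:R * (hi x)%:R).
  by apply: eq_bigr => x _; case: (weight_indicators x).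
have : (2 ^ m)%N%:R =
    \sum_(x : F) ((x == 0%R)%:R + (lo x)%:R + (mid x)%:R + (hi x)%:R) :> int.
  transitivity (\sum_(x : F) (1%R : int)); first by rewrite sumr_const cardT -cardE hF.
  by apply: eq_bigr => x _; case: (weight_indicators x).
rewrite sum_Walsh sum_Walsh_sqr sumrB !big_split /= -!mulr_sumr -!mulr_suml sum0 !mul1r.
rewrite !sumind exp2m; move: #|[set x | lo x]| #|[set x | mid x]| #|[set x | hi x]| => a z b.
have : (0 < p)%N by rewrite expn_gt0.
move: (2 ^ e)%N => q q0 E1 E2 E3.
(* The second moment gives a + b after cancelling 16 p^2, the first gives a - b after cancelling 4
   p, and the total count fixes z. *)
have E2' : (a + b = 4 * (q * q))%N.
  have : (16 * (q * q) * (a + b) == 16 * (q * q) * (4 * (q * q)))%N by apply/eqP; nia.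
  by rewrite eqn_pmul2l ?muln_gt0 ?q0 // => /eqP.
have E3' : (a = b + 2 * q)%N.
  have : (4 * q * a == 4 * q * (b + 2 * q))%N by apply/eqP; nia.
  by rewrite eqn_pmul2l ?muln_gt0 ?q0 // => /eqP.
by split; nia.
Qed.

(** Nonzero x has positive weight, so the additive map x to its codeword has trivial kernel; this
    gives dimension m. *)
Lemma codeword_inj : injective (codeword m D).
Proof.
move=> x y E; apply/eqP; rewrite -addx_eq0; apply: contraT => z0.
have : codeword m D (x + y) = 0.
  apply/ffunP => k; rewrite !ffunE mulrDl absTrD.
  have /ffunP/(_ k) := E; rewrite !ffunE => ->; exact: addxx.
move/(congr1 (@wt F _)); rewrite -codeword0 weight0.
have pp : (p <= p * p)%N by rewrite leq_pmulr ?expn_gt0.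
have := expn_gt0 2 e.
by case: (weight_values _ z0) => -[-> _]; lia.
Qed.

Lemma card_codeD_weight (k : nat) :
  #|[set c in codeD m D | wt c == k]| = #|[set x | weight x == k]|.
Proof.
rewrite -[RHS](card_imset _ codeword_inj); apply: eq_card => c; rewrite !inE.
apply/andP/imsetP => [[/imsetP[x _ ->] wx]|[x]]; first by exists x; rewrite ?inE.
by rewrite inE => wx ->; split=> //; apply: imset_f.
Qed.

End WeightDistribution.
End TwoToOne.
End FiniteField.

Theorem mainTheorem4 (F : finFieldType) (m i j : nat)
  (hF : #|F| = (2 ^ m)%N) (hm3 : (3 <= m)%N) (hmodd : odd m)
  (hij : (i < j)%N) (hjm : (j < m)%N)
  (h21 : forall y : F,
     #|[set x : F | Gamma (2 ^ i + 2 ^ j) x == y]| \in [:: 0%N; 2%N])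
  (hgcd : gcdn (2 ^ (j - i) + 1) (2 ^ m - 1) = 1%N) :
  let D := DGamma F (2 ^ i + 2 ^ j) in
  let C := codeD m D in
  let e := ((m - 3) %/ 2)%N in
  [/\ #|D| = (2 ^ (m - 1) - 1)%N,
      #|C| = (2 ^ m)%N,
      (exists c, [/\ c \in C, c != 0%R & wt c = (2 ^ (m - 2) - 2 ^ e)%N]),
      (forall c, c \in C -> c != 0%R -> (2 ^ (m - 2) - 2 ^ e <= wt c)%N) &
      (forall c, c \in C -> c != 0%R ->
         wt c \in [:: (2 ^ (m - 2) - 2 ^ e)%N; (2 ^ (m - 2))%N;
                      (2 ^ (m - 2) + 2 ^ e)%N])] /\
  [/\ #|[set c in C | wt c == 2 ^ (m - 2) - 2 ^ e]| = (2 ^ (m - 2) + 2 ^ e)%N,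
      #|[set c in C | wt c == 2 ^ (m - 2)]| = (2 ^ (m - 1) - 1)%N &
      #|[set c in C | wt c == 2 ^ (m - 2) + 2 ^ e]| = (2 ^ (m - 2) - 2 ^ e)%N].
Proof.
move=> D C e; have m_gt0 : (0 < m)%N by apply: leq_trans hm3.
have me : m = (2 * e + 3)%N.
  have : (m - 3 = 2 * e)%N by rewrite mulnC divnK // dvdn2 oddB // hmodd.
  by lia.
have E2 : 2 ^ (m - 2) = 2 * (2 ^ e * 2 ^ e).
  have -> : m - 2 = (e + e).+1 by lia.
  by rewrite expnS expnD.
have E1 : 2 ^ (m - 1) = 4 * (2 ^ e * 2 ^ e).
  have -> : m - 1 = (e + e).+2 by lia.
  by rewrite !expnS mulnA expnD.
have [n1 n2 n3] := weight_counts F m hF m_gt0 i j hij hjm h21 hgcd e me.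
have cnt := card_codeD_weight F m hF m_gt0 i j hij hjm h21 hgcd e me.
have vals c : c \in C -> c != 0%R -> [\/ wt c = 2 ^ (m - 2) - 2 ^ e,
    wt c = 2 ^ (m - 2) | wt c = 2 ^ (m - 2) + 2 ^ e].
  case/imsetP => x _ ->; have [->|x0 _] := eqVneq x 0%R.
    by rewrite codeword0 ?eqxx.
  rewrite E2; have := weight_values F m hF m_gt0 i j hij hjm h21 hgcd e me x x0.
  by case=> -[-> _]; [apply: Or31 | apply: Or32 | apply: Or33].
split; last by rewrite /C !cnt E1 E2.
have pp : 2 ^ e <= 2 ^ e * 2 ^ e by rewrite leq_pmulr ?expn_gt0.
have p0 := expn_gt0 2 e.
split.
- exact: card_DGamma.
- by rewrite card_imset; [exact: hF | exact: (codeword_inj F m hF m_gt0 i j hij hjm h21 hgcd e me)].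
- have /card_gt0P[x] : 0 < #|[set x | wt (codeword m D x) == 2 * (2 ^ e * 2 ^ e) - 2 ^ e]|.
    by rewrite n1; lia.
  rewrite inE => /eqP wx; exists (codeword m D x); split; rewrite ?E2 //.
    exact: imset_f.
  apply/eqP => c0; by move: wx; rewrite c0 wt0; lia.
- by move=> c cC c0; case: (vals c cC c0) => ->; lia.
- by move=> c cC c0; case: (vals c cC c0) => ->; rewrite !inE eqxx ?orbT.
Qed.
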